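(* Let $(V,(,,),\alpha=(\alpha_1,\alpha_2))$ be a ternary totally Hom-associative algebra (respectively, a Hom-Jordan triple system; respectively, a Hom-Lie triple system) and let $\beta\colon V\to V$ be a weak morphism, i.e. a linear map with $\beta((xyz))=(\beta(x)\beta(y)\beta(z))$ for all $x,y,z\in V$. Then the ternary Hom-algebra $$V_\beta=(V,\ (,,)_\beta=\beta\circ(,,),\ \beta\alpha=(\beta\alpha_1,\beta\alpha_2))$$ is a ternary totally Hom-associative algebra (respectively, a Hom-Jordan triple system; respectively, a Hom-Lie triple system). If, in addition, $V$ is multiplicative and $\beta\alpha=\alpha\beta$ (where $\alpha$ denotes the common twisting map), then $V_\beta$ is multiplicative.
   Context: We work over a fixed field $\mathbf{k}$ of characteristic $0$. A ternary Hom-algebra $(V,(,,),\alpha=(\alpha_1,\alpha_2))$ consists of a $\mathbf{k}$-module $V$, a trilinear map $(,,)\colon V^{\otimes 3}\to V$, written $(xyz)$, and linear maps $\alpha_1,\alpha_2\colon V\to V$ (the twisting maps). It is multiplicative if $\alpha_1=\alpha_2=\alpha$ and $\alpha\circ(,,)=(,,)\circ\alpha^{\otimes 3}$. The triple product may be denoted by other brackets. A ternary totally Hom-associative algebra is a ternary Hom-algebra with $((uvw)\alpha_1(x)\alpha_2(y))=(\alpha_1(u)(vwx)\alpha_2(y))=(\alpha_1(u)\alpha_2(v)(wxy))$ for all $u,v,w,x,y$. A Hom-Jordan triple system is a ternary Hom-algebra $(J,\{,,\},(\alpha_1,\alpha_2))$ with $\{xyz\}=\{zyx\}$ and $$\{\alpha_1(x)\alpha_2(y)\{uvw\}\}-\{\alpha_1(u)\alpha_2(v)\{xyw\}\}=\{\{xyu\}\alpha_1(v)\alpha_2(w)\}-\{\alpha_1(u)\{yxv\}\alpha_2(w)\}$$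 for all $u,v,w,x,y,z\in J$. A Hom-Lie triple system is a ternary Hom-algebra $(L,[,,],(\alpha_1,\alpha_2))$ with $[uvw]=-[vuw]$, $[uvw]+[wuv]+[vwu]=0$, and $$[\alpha_1(x)\alpha_2(y)[uvw]]=[[xyu]\alpha_1(v)\alpha_2(w)]+[\alpha_1(u)[xyv]\alpha_2(w)]+[\alpha_1(u)\alpha_2(v)[xyw]]$$ for all $u,v,w,x,y\in L$. *)

(* Defs.v *)
From HB Require Import structures.
From mathcomp Require Import all_boot all_order all_algebra.
Set Implicit Arguments.
Unset Strict Implicit.
Unset Printing Implicit Defensive.
Import GRing.Theory.
Local Open Scope ring_scope.

Definition trilinear (k : fieldType) (V : lmodType k) (m : V -> V -> V -> V) :
    Prop :=
  [/\ forall y z, linear (fun x => m x y z),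
      forall x z, linear (fun y => m x y z)
    & forall x y, linear (fun z => m x y z)].

Record ternaryHomAlg (k : fieldType) (V : lmodType k) := TernaryHomAlg {
  tprod : V -> V -> V -> V;
  twist1 : {linear V -> V};
  twist2 : {linear V -> V};
  tprod_trilinear : trilinear tprod
}.

Definition hom_multiplicative (k : fieldType) (V : lmodType k)
    (A : ternaryHomAlg V) : Prop :=
  twist1 A =1 twist2 A /\
  (forall x y z : V, twist1 A (tprod A x y z) =
     tprod A (twist1 A x) (twist1 A y) (twist1 A z)).

Definition totally_hom_associative (k : fieldType) (V : lmodType k)
    (A : ternaryHomAlg V) : Prop :=
  let m := tprod A in let a1 := twist1 A in let a2 := twist2 A in
  forall u v w x y : V,
    m (m u v w) (a1 x) (a2 y) = m (a1 u) (m v w x) (a2 y) /\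
    m (a1 u) (m v w x) (a2 y) = m (a1 u) (a2 v) (m w x y).

Definition hom_jordan_triple (k : fieldType) (V : lmodType k)
    (A : ternaryHomAlg V) : Prop :=
  let m := tprod A in let a1 := twist1 A in let a2 := twist2 A in
  (forall x y z : V, m x y z = m z y x) /\
  (forall u v w x y : V,
    m (a1 x) (a2 y) (m u v w) - m (a1 u) (a2 v) (m x y w) =
    m (m x y u) (a1 v) (a2 w) - m (a1 u) (m y x v) (a2 w)).

Definition hom_lie_triple (k : fieldType) (V : lmodType k)
    (A : ternaryHomAlg V) : Prop :=
  let m := tprod A in let a1 := twist1 A in let a2 := twist2 A in
  [/\ forall u v w : V, m u v w = - m v u w,
      forall u v w : V, m u v w + m w u v + m v w u = 0
    & forall u v w x y : V,
        m (a1 x) (a2 y) (m u v w) =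
        m (m x y u) (a1 v) (a2 w) + m (a1 u) (m x y v) (a2 w)
        + m (a1 u) (a2 v) (m x y w)].

Definition weak_morphism (k : fieldType) (V : lmodType k)
    (A : ternaryHomAlg V) (b : {linear V -> V}) : Prop :=
  forall x y z : V, b (tprod A x y z) = tprod A (b x) (b y) (b z).

Lemma trilinear_comp (k : fieldType) (V : lmodType k) (b : {linear V -> V})
    (m : V -> V -> V -> V) :
  trilinear m -> trilinear (fun x y z => b (m x y z)).
Proof.
by case=> m1 m2 m3; split=> s t a p q;
  rewrite ?(m1 s t a p q) ?(m2 s t a p q) ?(m3 s t a p q) linearP.
Qed.

Definition yau_twist (k : fieldType) (V : lmodType k) (A : ternaryHomAlg V)
    (b : {linear V -> V}) : ternaryHomAlg V :=
  {| tprod := fun x y z => b (tprod A x y z);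
     twist1 := b \o twist1 A;
     twist2 := b \o twist2 A;
     tprod_trilinear := trilinear_comp b (tprod_trilinear A) |}.

(* Main.v *)
(* Since b is a weak morphism, a nested product in the twisted algebra on
   twisted arguments is the image under b^2 of the same nested product in A:
   b(b(x y z) (b a1 s) (b a2 t)) = b^2((x y z) (a1 s) (a2 t)).  Every defining
   identity is linear in such terms, so it is transported by b or b^2. *)
Require Import Defs.
From HB Require Import structures.
From mathcomp Require Import all_boot all_order all_algebra.
Import GRing.Theory.
Local Open Scope ring_scope.

Lemma yau_twist_totally_hom_associative (k : fieldType) (V : lmodType k)
    (A : ternaryHomAlg V) (b : {linear V -> V}) :
  weak_morphism A b -> totally_hom_associative A ->
  totally_hom_associative (yau_twist A b).
Proof.
move=> bM assocA; rewrite /totally_hom_associative /= => u v w x y.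
by rewrite -!bM; have [-> ->] := assocA u v w x y.
Qed.

Lemma yau_twist_hom_jordan_triple (k : fieldType) (V : lmodType k)
    (A : ternaryHomAlg V) (b : {linear V -> V}) :
  weak_morphism A b -> hom_jordan_triple A ->
  hom_jordan_triple (yau_twist A b).
Proof.
move=> bM [symA jordanA]; split=> [x y z | u v w x y] /=; first by rewrite symA.
(* Each term becomes [b] applied twice to a term of [A]; additivity at both layers gathers each
   side's difference under b^2, where [jordanA] applies. *)
by rewrite -!bM -!linearB jordanA.
Qed.

Lemma yau_twist_hom_lie_triple (k : fieldType) (V : lmodType k)
    (A : ternaryHomAlg V) (b : {linear V -> V}) :
  weak_morphism A b -> hom_lie_triple A -> hom_lie_triple (yau_twist A b).
Proof.
move=> bM [altA cycA lieA]; split=> [u v w | u v w | u v w x y] /=.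
- by rewrite altA linearN.
(* The cyclic sum has no nested products, so it lies under a single [b]. *)
- by rewrite -!linearD cycA linear0.
- by rewrite -!bM -!linearD lieA.
Qed.

Lemma yau_twist_hom_multiplicative (k : fieldType) (V : lmodType k)
    (A : ternaryHomAlg V) (b : {linear V -> V}) :
  weak_morphism A b -> b \o twist1 A =1 twist1 A \o b ->
  hom_multiplicative A -> hom_multiplicative (yau_twist A b).
Proof.
move=> bM ba [a12 aM]; split=> [x | x y z] /=; first by rewrite a12.
(* Commutation at the product itself brings [twist1 A] directly onto it, where [aM] distributes it;
   then [bM] distributes the inner [b], while the outer one stays in place. *)
by have /= <- := ba (tprod A x y z); rewrite aM bM.
Qed.

Theorem theorem3p3 (k : fieldType) (char0 : [pchar k] =i pred0)
    (V : lmodType k) (A : ternaryHomAlg V) (b : {linear V -> V})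
    (b_morph : weak_morphism A b) :
  (totally_hom_associative A ->
     totally_hom_associative (yau_twist A b) /\
     (hom_multiplicative A -> b \o twist1 A =1 twist1 A \o b ->
        hom_multiplicative (yau_twist A b))) /\
  (hom_jordan_triple A ->
     hom_jordan_triple (yau_twist A b) /\
     (hom_multiplicative A -> b \o twist1 A =1 twist1 A \o b ->
        hom_multiplicative (yau_twist A b))) /\
  (hom_lie_triple A ->
     hom_lie_triple (yau_twist A b) /\
     (hom_multiplicative A -> b \o twist1 A =1 twist1 A \o b ->
        hom_multiplicative (yau_twist A b))).
Proof.
(* Multiplicativity is independent of the class of [A], so one proof serves all three cases. *)
have multA : hom_multiplicative A -> b \o twist1 A =1 twist1 A \o b ->
    hom_multiplicative (yau_twist A b).
  by move=> mA ba; apply: yau_twist_hom_multiplicative.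
split; last split; move=> hA; split=> //.
- exact: yau_twist_totally_hom_associative.
- exact: yau_twist_hom_jordan_triple.
- exact: yau_twist_hom_lie_triple.
Qed.
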